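(* For any step-size $h=\frac{T}{N}>0$, $N\in\mathbb{N}$, the numerical scheme (B) of the context is well-posed and positivity preserving, i.e., given a positive initial value $Y_0=x_0>0$, it admits a unique positive $\{\mathcal{F}_{t_n}\}_{n=0}^N$-adapted solution $\{Y_n\}_{n=0}^N$.
   Context: Notation: $\mathbb{N}$ is the set of positive integers, $D:=(0,\infty)$. Setting: $T\in(0,\infty)$; $(\Omega,\mathcal{F},\{\mathcal{F}_t\}_{t\ge0},\mathbb{P})$ is a filtered probability space with a normal filtration; $W$ is a standard Brownian motion and $\mathcal{N}$ a Poisson process with intensity $\lambda>0$, both with respect to $\{\mathcal{F}_t\}$, and independent of each other (the number of time steps is denoted $N$). The parameters satisfy $\alpha_{-1},\alpha_0,\alpha_1,\alpha_2,\sigma>0$, $r,\rho>1$, and either $r+1>2\rho$, or $r+1=2\rho$ with $\frac{\alpha_2}{\sigma^2}>\frac18\left(r+2+\frac1r\right)$. Let $f(x):=-\alpha_2x^r$, $g(x):=\sigma x^\rho$ for $x\in D$. The function $\nu:\mathbb{R}\to\mathbb{R}$ satisfies, for some constants $M,m>0$, $$|\nu(x)-\nu(y)|\le M|x-y|,\qquad x+\nu(x)>m\min\{1,x\},\qquad\text{for all }x,y\in D.$$ Scheme (B): for $N\in\mathbb{N}$ let $h=T/N$, $t_n=nh$, $\Delta W_n=W_{t_{n+1}}-W_{t_n}$, $\Delta \mathcal{N}_n=\mathcal{N}_{t_{n+1}}-\mathcal{N}_{t_n}$. The scheme is $Y_0=x_0$ and, for $n\in\{0,\dots,N-1\}$,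 $$Y_{n+1}=Y_n+(\alpha_{-1}Y_{n+1}^{-1}-\alpha_0+\alpha_1Y_n+f_h(Y_n))h+g_h(Y_n)\Delta W_n+\nu(Y_n)\Delta \mathcal{N}_n.$$ Conditions on $f_h,g_h$ (real-valued functions depending on $h$): there exist constants $L_1,L_2,L_3>0$ and $v>2$, independent of $h$, such that for every $h>0$ and all $x,y\in D$: (M1) $|f_h(x)|\le|f(x)|$ and $|g_h(x)|\le|g(x)|$; (M2) $|f(x)-f_h(x)|+|g(x)-g_h(x)|\le L_1h^{\frac12}(1+|x|^{2r})$; (M3) $|f_h(x)-f_h(y)|\le L_2(1+h^{-\frac12})|x-y|$; (M4) $(x-y)(f_h(x)-f_h(y))+\frac{v-1}{2}|g_h(x)-g_h(y)|^2\le L_3|x-y|^2$. *)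

(* Defs.v *)
From HB Require Export structures.
From mathcomp Require Export all_boot all_order all_algebra.
From mathcomp Require Export all_classical all_reals all_analysis.

Set Implicit Arguments.
Unset Strict Implicit.
Unset Printing Implicit Defensive.

Import Order.TTheory GRing.Theory Num.Theory.
Import numFieldNormedType.Exports.

Local Open Scope classical_set_scope.
Local Open Scope ring_scope.

(* Sets of subsets of Omega are used as (sub-)sigma-algebras; a real process is
   a function X : R -> Omega -> R of which only the times t >= 0 matter. *)

Definition sub_measurable (R : realType) (Omega : Type)
    (G : set (set Omega)) (X : Omega -> R) : Prop :=
  preimage_set_system setT X measurable `<=` G.

Definition indep_systems d (Omega : measurableType d) (R : realType)
    (P : probability Omega R) (G H : set (set Omega)) : Prop :=
  forall A B, G A -> H B -> P (A `&` B) = (P A * P B)%E.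

Definition process_sigma_algebra (R : realType) (Omega : Type)
    (X : R -> Omega -> R) : set (set Omega) :=
  <<s \bigcup_(t in [set t : R | 0 <= t])
        preimage_set_system setT (X t) measurable >>.

Definition is_filtration d (Omega : measurableType d) (R : realType)
    (F : R -> set (set Omega)) : Prop :=
  [/\ forall t, 0 <= t -> sigma_algebra setT (F t),
      forall t, 0 <= t -> F t `<=` measurable
    & forall s t, 0 <= s -> s <= t -> F s `<=` F t].

Definition normal_filtration d (Omega : measurableType d) (R : realType)
    (P : probability Omega R) (F : R -> set (set Omega)) : Prop :=
  [/\ is_filtration F,
      forall A, measurable A -> P A = 0%E -> F 0 A
    & forall t, 0 <= t -> F t = \bigcap_(s in [set s | t < s]) F s].

Definition adapted_process (R : realType) (Omega : Type)
    (F : R -> set (set Omega)) (X : R -> Omega -> R) : Prop :=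
  forall t, 0 <= t -> sub_measurable (F t) (X t).

Definition increments_indep_of_past d (Omega : measurableType d)
    (R : realType) (P : probability Omega R) (F : R -> set (set Omega))
    (X : R -> Omega -> R) : Prop :=
  forall s t, 0 <= s -> s < t ->
    indep_systems P (preimage_set_system setT (X t \- X s) measurable) (F s).

(* The second parameter of normal_prob is the standard deviation. *)
Definition brownian_motion d (Omega : measurableType d) (R : realType)
    (P : probability Omega R) (F : R -> set (set Omega))
    (W : R -> Omega -> R) : Prop :=
  [/\ adapted_process F W,
      {ae P, forall w, W 0 w = 0},
      increments_indep_of_past P F W,
      forall s t (B : set R), 0 <= s -> s < t -> measurable B ->
        P ((W t \- W s) @^-1` B) = normal_prob 0 (Num.sqrt (t - s)) B
    & {ae P, forall w, {within `[0, +oo[, continuous (fun t => W t w)}}].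

(* The process is real-valued; since the Poisson weights sum to 1, its
   increments are natural numbers almost surely. *)
Definition poisson_process d (Omega : measurableType d) (R : realType)
    (P : probability Omega R) (F : R -> set (set Omega)) (lambda : R)
    (X : R -> Omega -> R) : Prop :=
  [/\ adapted_process F X,
      {ae P, forall w, X 0 w = 0},
      increments_indep_of_past P F X,
      forall s t (k : nat), 0 <= s -> s < t ->
        P [set w | X t w - X s w = k%:R]
        = (poisson_pmf (lambda * (t - s)) k)%:E
    & {ae P, forall w,
        (forall t, 0 <= t -> X s w @[s --> t^'+] --> X t w) /\
        (forall t, 0 < t -> cvg (X s w @[s --> t^'-]))}].

Definition parameter_condition (R : realType) (alpha2 sigma r rho : R) : Prop :=
  2 * rho < r + 1 \/
  (r + 1 = 2 * rho /\ 8^-1 * (r + 2 + r^-1) < alpha2 / sigma ^+ 2).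

Definition drift_f (R : realType) (alpha2 r x : R) : R := - alpha2 * x `^ r.

Definition diffusion_g (R : realType) (sigma rho x : R) : R := sigma * x `^ rho.

Definition jump_condition (R : realType) (nu : R -> R) : Prop :=
  exists M m : R, [/\ 0 < M, 0 < m,
    forall x y, 0 < x -> 0 < y -> `|nu x - nu y| <= M * `|x - y|
  & forall x, 0 < x -> m * Num.min 1 x < x + nu x].

(* fh h and gh h are the modified coefficients for the step size h; the
   constants L1, L2, L3, v do not depend on h. *)
Definition modification_condition (R : realType) (r : R) (f g : R -> R)
    (fh gh : R -> R -> R) : Prop :=
  exists L1 L2 L3 v : R, [/\ 0 < L1, 0 < L2, 0 < L3, 2 < v &
    forall h x y : R, 0 < h -> 0 < x -> 0 < y ->
    [/\ `|fh h x| <= `|f x| /\ `|gh h x| <= `|g x|,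
        `|f x - fh h x| + `|g x - gh h x|
          <= L1 * h `^ (2^-1) * (1 + `|x| `^ (2 * r)),
        `|fh h x - fh h y| <= L2 * (1 + h `^ (- 2^-1)) * `|x - y|
      & (x - y) * (fh h x - fh h y)
          + (v - 1) / 2 * `|gh h x - gh h y| ^+ 2
          <= L3 * `|x - y| ^+ 2]].

(* The scheme along one sample path: dW and dN are the increments of the
   Brownian motion and of the Poisson process, y the path of the scheme.
   It is implicit in y n.+1. *)
Definition solves_scheme (R : realType) (alpham1 alpha0 alpha1 h : R)
    (fh gh nu : R -> R) (x0 : R) (N : nat) (dW dN y : nat -> R) : Prop :=
  y 0%N = x0 /\
  forall n, (n < N)%N ->
    y n.+1 = y n
      + (alpham1 * (y n.+1)^-1 - alpha0 + alpha1 * y n + fh (y n)) * h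
      + gh (y n) * dW n + nu (y n) * dN n.

Definition positive_path (R : realType) (N : nat) (y : nat -> R) : Prop :=
  forall n, (n <= N)%N -> 0 < y n.

Definition adapted_sequence (R : realType) (Omega : Type)
    (F : R -> set (set Omega)) (t : nat -> R) (N : nat)
    (Y : nat -> Omega -> R) : Prop :=
  forall n, (n <= N)%N -> sub_measurable (F (t n)) (Y n).

(* Main.v *)
(** Multiplying one step of the scheme by [Y_{n+1}] gives the quadratic equation
    [y ^ 2 - c y - alpha_{-1} h = 0], where [c] is the explicit part of the step.
    Its roots have the negative product [- alpha_{-1} h], so exactly one of them
    is positive; it is a continuous function of [c].  Adaptedness follows because
    [f_h], [g_h] and [nu] are Lipschitz on (0, oo): for [g_h] this comes from
    combining (M3) with (M4). *)

Require Import Defs.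
From mathcomp Require Import measurable_realfun ring lra.
Import Order.TTheory GRing.Theory Num.Theory.
Import numFieldNormedType.Exports.

Local Open Scope classical_set_scope.
Local Open Scope ring_scope.

Set Implicit Arguments.
Unset Strict Implicit.
Unset Printing Implicit Defensive.

(** A sigma-algebra equals the one it generates, so measurability with respect to [G] becomes
    [measurable_fun] on [g_sigma_algebraType G], where the closure properties of measurable
    functions apply. *)
Lemma sub_measurableE (d : measure_display) (Omega : measurableType d)
    (R : realType) (G : set (set Omega)) (X : Omega -> R) :
  sigma_algebra setT G ->
  sub_measurable G X <-> measurable_fun setT (X : g_sigma_algebraType G -> R).
Proof.
move=> sG; have mG : G.-sigma.-measurable = G by exact: sigma_algebra_id.
split=> [GX _ B mB|mX _ [B mB <-]].
  by rewrite mG; apply: GX; exists B.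
by rewrite -mG; exact: mX.
Qed.

Lemma lipschitz_measurable_fun (R : realType) (D : set R) (u : R -> R) (L : R) :
  open D -> (forall x y, D x -> D y -> `|u x - u y| <= L * `|x - y|) ->
  measurable_fun D u.
Proof.
move=> oD uL; apply: open_continuous_measurable_fun => // x /set_mem Dx.
have nD : nbhs x D by apply: open_nbhs_nbhs; split.
apply/cvgrPdist_lt => e e0; near=> y.
(* The sign of [L] is arbitrary; [|L| + 1] is a positive Lipschitz constant by which [e] can be
   divided. *)
have L0 : 0 < `|L| + 1 by rewrite ltr_wpDl.
apply: (@le_lt_trans _ _ ((`|L| + 1) * `|x - y|)).
  apply: le_trans (uL x y Dx _) _; first by near: y; exact: nD.
  by apply: ler_wpM2r => //; rewrite (le_trans (ler_norm L))// lerDl.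
rewrite mulrC -ltr_pdivlMr //; near: y.
by apply: cvgr_dist_lt; rewrite ?divr_gt0.
Unshelve. all: by end_near. Qed.

Lemma measurable_fun_comp_pos (R : realType) (d : measure_display)
    (Omega : measurableType d) (u : R -> R) (X : Omega -> R) :
  measurable_fun [set x : R | 0 < x] u -> (forall w, 0 < X w) ->
  measurable_fun setT X -> measurable_fun setT (fun w => u (X w)).
Proof.
move=> mu X0 mX; apply: (measurable_comp _ _ mu mX).
  by apply: open_measurable; exact: open_gt.
by move=> _ [w _ <-]; exact: X0.
Qed.

(** The Lipschitz bound on [f] gives [(x - y) * (f x - f y) >= - K * |x - y| ^+ 2]. Moving this
    product to the right-hand side leaves [a * |g x - g y| ^+ 2 <= (L + K) * |x - y| ^+ 2]. *)
Lemma monotone_lipschitz (R : realType) (f g : R -> R) (x y a K L : R) :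
  0 < a ->
  (x - y) * (f x - f y) + a * `|g x - g y| ^+ 2 <= L * `|x - y| ^+ 2 ->
  `|f x - f y| <= K * `|x - y| ->
  `|g x - g y| <= Num.sqrt ((L + K) / a) * `|x - y|.
Proof.
move=> a0 fgL fK.
have aux : a * `|g x - g y| ^+ 2 <= (L + K) * `|x - y| ^+ 2.
  have : - ((x - y) * (f x - f y)) <= K * `|x - y| ^+ 2.
    rewrite (le_trans (ler_norm _)) // normrN normrM expr2 mulrCA.
    exact: ler_wpM2l.
  by rewrite mulrDl; lra.
have : `|g x - g y| ^+ 2 <= (L + K) / a * `|x - y| ^+ 2.
  by rewrite mulrAC ler_pdivlMr // mulrC.
have [LK0|LK0] := leP 0 ((L + K) / a) => gLK.
  by rewrite -ler_sqr ?nnegrE ?mulr_ge0 ?sqrtr_ge0 // exprMn sqr_sqrtr.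
(* For a negative radicand [Num.sqrt] is 0, so [g x = g y] is required; it holds because [gLK]
   bounds a square by a nonpositive number. *)
rewrite ler0_sqrtr ?(ltW LK0) // mul0r normr_le0 -sqrf_eq0 -real_normK ?num_real //.
rewrite eq_le sqr_ge0 andbT (le_trans gLK) // mulr_le0_ge0 ?sqr_ge0 //.
exact: ltW.
Qed.

(** The larger root of [y ^+ 2 - c * y - b]. *)
Definition implicit_root (R : rcfType) (b c : R) : R :=
  (c + Num.sqrt (c ^+ 2 + 4 * b)) / 2.

(** For [b > 0] the square root strictly exceeds [Num.sqrt (c ^+ 2) = |c| >= - c]. *)
Lemma implicit_root_gt0 (R : rcfType) (b c : R) : 0 < b -> 0 < implicit_root b c.
Proof.
move=> b0; apply: divr_gt0 => //; rewrite -ltrBlDl sub0r.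
rewrite (le_lt_trans (ler_norm _)) // normrN -sqrtr_sqr.
by rewrite ltr_sqrt ?ltrDl ?mulr_gt0 // ltr_wpDl ?sqr_ge0 ?mulr_gt0.
Qed.

Lemma implicit_rootE (R : rcfType) (b c y : R) : 0 < b -> 0 < y ->
  y = c + b / y <-> y = implicit_root b c.
Proof.
move=> b0 y0; have y_neq0 : y != 0 by rewrite gt_eqF.
have z0 := implicit_root_gt0 c b0; set z := implicit_root b c in z0 *.
have z_neq0 : z != 0 by rewrite gt_eqF.
have zE : z ^+ 2 = c * z + b.
  have : (2 * z - c) ^+ 2 = c ^+ 2 + 4 * b.
    rewrite -[RHS]sqr_sqrtr; last by rewrite addr_ge0 ?sqr_ge0 ?mulr_ge0 ?ltW.
    by congr (_ ^+ 2); rewrite /z /implicit_root; field.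
  by nra.
split=> [yE|->]; last by rewrite -[LHS](mulfK z_neq0) -expr2 zE; field.
have yE2 : y ^+ 2 = c * y + b by rewrite [in LHS]expr2 [X in X * _ = _]yE; field.
(* Eliminating [c] from the quadratic equations of [y] and [z] gives
   [z * y ^+ 2 - y * z ^+ 2 = b * (z - y)]; the second factor is positive, so [y = z]. *)
have : (y - z) * (z * y + b) = 0 by nra.
have zyb : z * y + b != 0 by rewrite gt_eqF // addr_gt0 // mulr_gt0.
by move/eqP; rewrite mulf_eq0 (negbTE zyb) orbF subr_eq0 => /eqP.
Qed.

Lemma measurable_implicit_root (R : realType) (b : R) :
  measurable_fun setT (implicit_root b).
Proof.
apply: continuous_measurable_fun => c; apply: cvgMl.
apply: cvgD => //; apply: continuous_comp; last exact: sqrt_continuous.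
by apply: cvgD; [exact: exprn_continuous|exact: cvg_cst].
Qed.

Section scheme.
Variables (R : realType) (a h alpha0 alpha1 : R) (f g nu : R -> R) (x0 : R).

Definition explicit_part (y dw dn : R) : R :=
  y + (- alpha0 + alpha1 * y + f y) * h + g y * dw + nu y * dn.

(** The increments are plain sequences, so that existence and uniqueness are deterministic
    statements about a single sample path. *)
Fixpoint scheme_path (dW dN : nat -> R) (n : nat) : R :=
  if n is n'.+1 then
    let y := scheme_path dW dN n' in
    implicit_root (a * h) (explicit_part y (dW n') (dN n'))
  else x0.

Hypotheses (ah0 : 0 < a * h) (x0_gt0 : 0 < x0).

Lemma scheme_path_gt0 dW dN n : 0 < scheme_path dW dN n.
Proof. by case: n => [|n] //=; exact: implicit_root_gt0. Qed.

Lemma scheme_stepE y z dw dn : 0 < z ->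
  z = y + (a * z^-1 - alpha0 + alpha1 * y + f y) * h + g y * dw + nu y * dn <->
  z = implicit_root (a * h) (explicit_part y dw dn).
Proof.
move=> z0; rewrite -implicit_rootE // /explicit_part.
suff -> : y + (a * z^-1 - alpha0 + alpha1 * y + f y) * h + g y * dw + nu y * dn =
  y + (- alpha0 + alpha1 * y + f y) * h + g y * dw + nu y * dn + a * h / z by [].
by ring.
Qed.

Lemma scheme_path_solves N dW dN :
  solves_scheme a alpha0 alpha1 h f g nu x0 N dW dN (scheme_path dW dN).
Proof.
by split=> // n _; apply/scheme_stepE => //; exact: scheme_path_gt0.
Qed.

Lemma scheme_path_unique N dW dN y : positive_path N y ->
  solves_scheme a alpha0 alpha1 h f g nu x0 N dW dN y ->
  forall n, (n <= N)%N -> y n = scheme_path dW dN n.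
Proof.
move=> y0 [yx0 yS]; elim=> [//|n IH] nN.
have /scheme_stepE -> := yS n nN; last exact: y0.
by rewrite IH // ltnW.
Qed.

(** The coefficients are only known to be measurable on the positive half-line, hence the positivity
    of [X]. [Omega] is generic so that it can carry the sigma-algebra [F (t n.+1)]. *)
Lemma measurable_scheme_step d (Omega : measurableType d) (X dw dn : Omega -> R) :
  measurable_fun [set x : R | 0 < x] f -> measurable_fun [set x : R | 0 < x] g ->
  measurable_fun [set x : R | 0 < x] nu ->
  (forall w, 0 < X w) -> measurable_fun setT X ->
  measurable_fun setT dw -> measurable_fun setT dn ->
  measurable_fun setT
    (fun w => implicit_root (a * h) (explicit_part (X w) (dw w) (dn w))).
Proof.
move=> mf mg mnu X0 mX mdw mdn.
apply: (measurableT_comp (measurable_implicit_root (a * h))).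
apply: measurable_funD; first apply: measurable_funD; first apply: measurable_funD => //.
- apply: measurable_funM => //; apply: measurable_funD.
    by apply: measurable_funD => //; exact: measurable_funM.
  exact: measurable_fun_comp_pos.
- by apply: measurable_funM => //; exact: measurable_fun_comp_pos.
- by apply: measurable_funM => //; exact: measurable_fun_comp_pos.
Qed.

End scheme.

Theorem lemma3p4 (R : realType) (d : measure_display)
    (Omega : measurableType d) (P : probability Omega R)
    (F : R -> set (set Omega)) (W Np : R -> Omega -> R)
    (T lambda alpham1 alpha0 alpha1 alpha2 sigma r rho x0 : R)
    (nu : R -> R) (fh gh : R -> R -> R) (N : nat)
    (hF : normal_filtration P F)
    (hlambda : 0 < lambda)
    (hW : brownian_motion P F W)
    (hNp : poisson_process P F lambda Np)
    (hWNp : indep_systems P (process_sigma_algebra W)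
                            (process_sigma_algebra Np))
    (hT : 0 < T)
    (halpham1 : 0 < alpham1) (halpha0 : 0 < alpha0) (halpha1 : 0 < alpha1)
    (halpha2 : 0 < alpha2) (hsigma : 0 < sigma)
    (hr : 1 < r) (hrho : 1 < rho)
    (hparam : parameter_condition alpha2 sigma r rho)
    (hnu : jump_condition nu)
    (hM : modification_condition r (drift_f alpha2 r) (diffusion_g sigma rho)
            fh gh)
    (hN : (0 < N)%N)
    (hx0 : 0 < x0) :
  let h := T / N%:R in
  let t := fun n : nat => n%:R * h in
  let solves_at := fun (Y : nat -> Omega -> R) (w : Omega) =>
    solves_scheme alpham1 alpha0 alpha1 h (fh h) (gh h) nu x0 N
      (fun n => W (t n.+1) w - W (t n) w)
      (fun n => Np (t n.+1) w - Np (t n) w)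
      (fun n => Y n w) in
  let positive_at := fun (Y : nat -> Omega -> R) (w : Omega) =>
    positive_path N (fun n => Y n w) in
  exists Y : nat -> Omega -> R,
    [/\ adapted_sequence F t N Y,
        forall w, positive_at Y w,
        forall w, solves_at Y w
      & forall Y' : nat -> Omega -> R,
          adapted_sequence F t N Y' ->
          forall w, positive_at Y' w -> solves_at Y' w ->
          forall n, (n <= N)%N -> Y' n w = Y n w].
Proof.
move=> h t solves_at positive_at.
have h0 : 0 < h by rewrite divr_gt0 ?ltr0n.
have ah0 : 0 < alpham1 * h by rewrite mulr_gt0.
have t0 n : 0 <= t n by rewrite mulr_ge0 // ltW.
have tS n : t n <= t n.+1 by rewrite ler_wpM2r ?ler_nat // ltW.
have opos : open [set x : R | 0 < x] by exact: open_gt.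
have mnu : measurable_fun [set x : R | 0 < x] nu.
  by case: hnu => M [m [_ _ nuM _]]; exact: lipschitz_measurable_fun nuM.
have [mf mg] : measurable_fun [set x : R | 0 < x] (fh h) /\
               measurable_fun [set x : R | 0 < x] (gh h).
  have [L1 [L2 [L3 [v [_ _ _ v2 M]]]]] := hM.
  split.
    apply: (@lipschitz_measurable_fun _ _ _ (L2 * (1 + h `^ (- 2^-1)))) => //.
    by move=> x y x0' y0; case: (M h x y h0 x0' y0).
  (* This is the constant of [monotone_lipschitz] with [a = (v - 1) / 2], [L = L3] and [K] the
     Lipschitz constant from (M3). It may depend on [h], which is fixed here. *)
  apply: (@lipschitz_measurable_fun _ _ _
    (Num.sqrt ((L3 + L2 * (1 + h `^ (- 2^-1))) / ((v - 1) / 2)))) => //.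
  move=> x y x0' y0; have [_ _ M3 M4] := M h x y h0 x0' y0.
  by apply: monotone_lipschitz M4 M3; lra.
have [[sF _ incF] _ _] := hF.
have [adW _ _ _ _] := hW.
have [adNp _ _ _ _] := hNp.
pose dX (X : R -> Omega -> R) w n := X (t n.+1) w - X (t n) w.
pose Y n w :=
  scheme_path alpham1 h alpha0 alpha1 (fh h) (gh h) nu x0 (dX W w) (dX Np w) n.
exists Y; split.
- move=> n _; elim: n => [|n IH]; apply/(sub_measurableE _ (sF _ (t0 _))).
    exact: measurable_cst.
  (* Step [n] is carried out on [F (t n.+1)], so the quantities known at time [t n] are first moved
     there by monotonicity of the filtration. *)
  have lift X : sub_measurable (F (t n)) X -> measurable_fun setT
      (X : g_sigma_algebraType (F (t n.+1)) -> R).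
    move=> mX; apply/(sub_measurableE _ (sF _ (t0 _))).
    exact: subset_trans mX (incF _ _ (t0 n) (tS n)).
  have mdX (X : R -> Omega -> R) : adapted_process F X ->
      measurable_fun setT (fun w : g_sigma_algebraType (F (t n.+1)) => dX X w n).
    move=> adX; apply: measurable_funB; last exact: lift (adX _ (t0 n)).
    by apply/(sub_measurableE _ (sF _ (t0 _))); exact: adX.
  apply: measurable_scheme_step => //; [|exact: lift|exact: mdX|exact: mdX].
  by move=> w; exact: scheme_path_gt0.
- by move=> w n _; exact: scheme_path_gt0.
- by move=> w; exact: scheme_path_solves.
- by move=> Y' _ w Y'0 Y'S; exact: scheme_path_unique Y'0 Y'S.
Qed.
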